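(* Fix a positive integer $n$, and let $q$ be a positive integer that varies. If $a_1,\dots,a_n\in\{1,\dots,q\}$ are chosen uniformly and independently at random, then the probability that $\mathcal{S}=\langle a_1,\dots,a_n\rangle$ has full normalescence rank tends to $1$ as $q\to\infty$. More precisely, this probability is $1-O(q^{-1/n})$ as $q\to\infty$ (for fixed $n$).
   Context: Let $\mathbb{N}=\{0,1,2,\dots\}$. A numerical semigroup is a set $\mathcal{S}\subseteq\mathbb{N}$ that contains $0$ and is closed under addition. For positive integers $a_1,\dots,a_n$, $\langle a_1,\dots,a_n\rangle=\{a_1x_1+\cdots+a_nx_n : x_i\in\mathbb{N}\}$. The embedding dimension $\mathsf{e}(\mathcal{S})$ is the number of elements of the unique minimal generating set of $\mathcal{S}$. A rational polyhedral cone in $\mathbb{R}^m$ is a pointed (containing no line) set of the form $\operatorname{cone}(\mathbf{v}_1,\dots,\mathbf{v}_\ell)=\{\sum_i\lambda_i\mathbf{v}_i:\lambda_i\in\mathbb{R}_{\ge 0}\}$ with $\mathbf{v}_i\in\mathbb{Z}^m$; its dimension is the dimension of its linear span. A numerical semigroup $\mathcal{S}$ is $k$-normalescent if $\mathcal{S}=\pi(\mathcal{C}\cap\mathbb{Z}^m)$ for some $m$, some $k$-dimensional rational polyhedral cone $\mathcal{C}\subseteq\mathbb{R}^m$, and some linear map $\pi:\mathbb{R}^m\to\mathbb{R}$ with integer coefficients. The normalescence rank of $\mathcal{S}$ is the smallest $k$ such that $\mathcal{S}$ is $k$-normalescent; it is always at most $\mathsf{e}(\mathcal{S})$, and $\mathcal{S}$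 has full normalescence rank if its normalescence rank equals $\mathsf{e}(\mathcal{S})$. *)

(* Defs.v *)
From HB Require Import structures.
From mathcomp Require Import all_boot all_order all_algebra.
From mathcomp Require Import all_classical all_reals all_analysis.

Set Implicit Arguments.
Unset Strict Implicit.
Unset Printing Implicit Defensive.

Import Order.TTheory GRing.Theory Num.Theory.
Import numFieldNormedType.Exports.

Local Open Scope classical_set_scope.
Local Open Scope ring_scope.

(* No finiteness condition on the complement. *)
Definition numerical_semigroup (S : set nat) : Prop :=
  S 0%N /\ forall x y, S x -> S y -> S (x + y)%N.

Definition gen_by (n : nat) (a : 'I_n -> nat) : set nat :=
  [set s | exists x : 'I_n -> nat, s = (\sum_(i < n) a i * x i)%N].

Definition generates (A S : set nat) : Prop :=
  smallest numerical_semigroup A = S.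

Definition minimal_generating_set (A S : set nat) : Prop :=
  generates A S /\ forall B, B `<=` A -> generates B S -> B = A.

Definition embedding_dimension (S : set nat) (e : nat) : Prop :=
  exists2 A, minimal_generating_set A S & (A #= `I_e)%card.

Section Normalescence.
Variable R : realType.

Definition intvec (m : nat) (z : 'rV[int]_m) : 'rV[R]_m := map_mx intr z.

Definition cone (m l : nat) (v : 'I_l -> 'rV[R]_m) : set 'rV[R]_m :=
  [set x | exists lam : 'I_l -> R,
     (forall i, 0 <= lam i) /\ x = \sum_(i < l) lam i *: v i].

Definition pointed (m : nat) (C : set 'rV[R]_m) : Prop :=
  ~ exists x d : 'rV[R]_m, d != 0 /\ forall t : R, C (x + t *: d).

Definition rational_polyhedral_cone (m : nat) (C : set 'rV[R]_m) : Prop :=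
  pointed C /\
  exists l, exists v : 'I_l -> 'rV[int]_m, C = cone (fun i => intvec (v i)).

Definition linear_span (m : nat) (C : set 'rV[R]_m)
    (U : {vspace 'rV[R]_m}) : Prop :=
  C `<=` [set` U] /\
  forall W : {vspace 'rV[R]_m}, C `<=` [set` W] -> (U <= W)%VS.

Definition cone_dimension (m : nat) (C : set 'rV[R]_m) (k : nat) : Prop :=
  exists2 U : {vspace 'rV[R]_m}, linear_span C U & \dim U = k.

Definition int_linear_map (m : nat) (c : 'I_m -> int) (x : 'rV[R]_m) : R :=
  \sum_(j < m) (c j)%:~R * x ord0 j.

(* The equality pi (C `&` Z^m) = S is stated in R, where pi takes its values. *)
Definition normalescent (k : nat) (S : set nat) : Prop :=
  exists m, exists C : set 'rV[R]_m, exists c : 'I_m -> int,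
    [/\ rational_polyhedral_cone C, cone_dimension C k &
        int_linear_map c @` (C `&` range (@intvec m)) =
        [set s%:R | s in S] ].

Definition normalescence_rank (S : set nat) (k : nat) : Prop :=
  normalescent k S /\ forall j, normalescent j S -> (k <= j)%N.

Definition full_normalescence_rank (S : set nat) : Prop :=
  exists2 e, embedding_dimension S e & normalescence_rank S e.

(* Uniform measure on {1, ..., q}^n: f : 'I_n -> 'I_q encodes the tuple
   a_i = f i + 1. For q = 0 (and n > 0) the value is the junk 0 / 0 = 0. *)
Definition prob_full_rank (n q : nat) : R :=
  #|[pred f : {ffun 'I_n -> 'I_q} |
      `[< full_normalescence_rank (gen_by (fun i => (f i).+1)) >] ]|%:R
  / (q ^ n)%:R.

End Normalescence.

(* Main.v *)
Require Import Defs.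
From HB Require Import structures.
From mathcomp Require Import all_boot all_order all_algebra.
From mathcomp Require Import all_classical all_reals all_analysis.
From mathcomp Require Import zify ring lra.

Import Order.TTheory GRing.Theory Num.Theory.
Import numFieldNormedType.Exports.

Local Open Scope classical_set_scope.
Local Open Scope ring_scope.

(** Suppose [gen_by a] is the image of the lattice points of a cone spanning
    fewer than [n] dimensions, and choose lattice points [w_i] of the cone over
    the [a_i]. They satisfy a nontrivial relation [\sum_i d_i w_i = 0]; let
    [|d_i0|] be maximal and put [z_i = ceil (- d_i / d_i0)], so that [z_i <= 1]
    and [z_i0 = -1]. The lattice point
    [\sum_i z_i w_i = \sum_i (z_i + d_i / d_i0) w_i] lies in the cone, hence
    [\sum_i z_i a_i = \sum_i x_i a_i] with [x_i >= 0], and [x - z] is a nonzero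
    integer relation between the [a_i] all of whose coefficients are at least
    [-1]. If there is no such relation, then the [a_i] moreover generate
    minimally, and the rank is full.

    To count the tuples in [{1, ..., q}^n] with such a relation, let
    [m ~ q^(1/n)]. At most [n (q / m) q^(n-1)] tuples have an entry at most
    [q / m]. For the others the coefficients of the relation are less than
    [n m]; some coefficient is [-1], so the corresponding entry is determined by
    the other [n - 1] entries and coefficients, and there are at most
    [n (n m + 1)^(n-1) q^(n-1)] such tuples. *)

(** * Semigroups given by generators *)

Lemma gen_by_mem (n : nat) (a : 'I_n -> nat) (i : 'I_n) : gen_by a (a i).
Proof.
exists (fun j => (j == i) : nat).
rewrite (bigD1 i) //= eqxx muln1 big1 ?addn0 //.
by move=> j /negbTE->; rewrite muln0.
Qed.

Lemma gen_by_semigroup (n : nat) (a : 'I_n -> nat) :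
  numerical_semigroup (gen_by a).
Proof.
split; first by exists (fun=> 0%N); rewrite big1 // => i _; rewrite muln0.
move=> _ _ [x ->] [y ->]; exists (fun i => x i + y i)%N.
by rewrite -big_split; apply: eq_bigr => i _; rewrite mulnDr.
Qed.

Lemma gen_by_sub (n : nat) (a : 'I_n -> nat) (S : set nat) :
  numerical_semigroup S -> (forall i, S (a i)) -> gen_by a `<=` S.
Proof.
move=> [S0 SD] Sa _ [x ->]; apply: big_ind => // i _.
by elim: (x i) => [|k IH]; rewrite ?muln0 // mulnS; exact: SD.
Qed.

Lemma gen_by_generates (n : nat) (a : 'I_n -> nat) :
  generates (range a) (gen_by a).
Proof.
apply/seteqP; split.
  apply: (@smallest_sub _ numerical_semigroup); first exact: gen_by_semigroup.
  by move=> _ [i _ <-]; exact: gen_by_mem.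
by move=> s as_ T [semT aT]; apply: gen_by_sub s as_ => // i; exact: aT.
Qed.

(** * Cones, linear dependence and the orthant *)

Lemma cone_comb (R : realType) (m l : nat) (v : 'I_l -> 'rV[R]_m) (p : nat)
    (w : 'I_p -> 'rV[R]_m) (lam : 'I_p -> R) :
  (forall i, 0 <= lam i) -> (forall i, cone v (w i)) ->
  cone v (\sum_(i < p) lam i *: w i).
Proof.
move=> lam0 vw; apply: (big_ind (cone v)).
- by exists (fun=> 0); split=> //; rewrite big1 // => i _; rewrite scale0r.
- move=> _ _ [x [x0 ->]] [y [y0 ->]]; exists (fun i => x i + y i).
  split=> [i|]; first exact: addr_ge0.
  by rewrite -big_split; apply: eq_bigr => i _; rewrite scalerDl.
- move=> i _; have [x [x0 ->]] := vw i; exists (fun j => lam i * x j).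
  split=> [j|]; first exact: mulr_ge0.
  by rewrite scaler_sumr; apply: eq_bigr => j _; rewrite scalerA.
Qed.

Lemma exists_dependency (R : realType) (n m : nat)
    (w : 'I_n -> 'rV[R]_m) (U : {vspace 'rV[R]_m}) :
  (forall i, w i \in U) -> (\dim U < n)%N ->
  exists c : 'I_n -> R, \sum_(i < n) c i *: w i = 0 /\ exists i, c i != 0.
Proof.
move=> wU Un; apply: contrapT => nc.
have : free [tuple w i | i < n].
  apply/freeP => c c0 i; apply/eqP/negPn/negP => ci; apply: nc; exists c.
  split; last by exists i.
  by rewrite -[RHS]c0; apply: eq_bigr => j _; rewrite -tnth_nth tnth_mktuple.
rewrite /free size_tuple => /eqP dimX.
have : (<<[tuple w i | i < n]>> <= U)%VS.
  by apply/span_subvP => _ /mapP[i _ ->].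
by move=> /dimvS; rewrite dimX leqNgt Un.
Qed.

Lemma int_linear_map_sum (R : realType) (m : nat) (c : 'I_m -> int)
    (p : nat) (z : 'I_p -> R)
    (w : 'I_p -> 'rV[R]_m) :
  int_linear_map c (\sum_(i < p) z i *: w i) =
  \sum_(i < p) z i * int_linear_map c (w i).
Proof.
rewrite /int_linear_map; under [RHS]eq_bigr do rewrite mulr_sumr.
rewrite [RHS]exchange_big; apply: eq_bigr => j _.
rewrite summxE mulr_sumr; apply: eq_bigr => i _; rewrite mxE; ring.
Qed.

Lemma orthantP (R : realType) (p : nat) (x : 'rV[R]_p) :
  cone (fun i => intvec R (delta_mx 0 i)) x <-> forall i, 0 <= x 0 i.
Proof.
have E (y : 'I_p -> R) i :
    (\sum_j y j *: intvec R (delta_mx 0 j)) 0 i = y i.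
  rewrite summxE (bigD1 i) //= big1 ?addr0 => [|j ji].
    by rewrite !mxE !eqxx mulr1.
  by rewrite !mxE eqxx (eq_sym i) (negbTE ji) mulr0.
split=> [[lam [lam0 ->]] i|x0]; first by rewrite E.
exists (fun i => x 0 i); split=> //.
by apply/rowP => i; rewrite E.
Qed.

(** The nonnegative orthant with the functional of coefficients [a i] is a witness; this bounds the
    rank above by [n]. *)
Lemma gen_by_normalescent (R : realType) (n : nat) (a : 'I_n -> nat) :
  normalescent R n (gen_by a).
Proof.
pose C := cone (fun i : 'I_n => intvec R (delta_mx 0 i)).
exists n, C, (fun i => (a i)%:Z); split.
- split; last by exists n, (fun i => delta_mx 0 i).
  move=> [x [d [/rV0Pn[j dj] Cxd]]].
  (* At this parameter the [j]-th coordinate of the line equals -1. *)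
  have /orthantP/(_ j) := Cxd (- (x 0 j + 1) / d 0 j).
  by rewrite !mxE divfK // opprD addrA subrr sub0r oppr_ge0 ler10.
- exists fullv; last by rewrite dimvf /dim /= mul1n.
  split=> [x _|W CW]; first by rewrite /= memvf.
  apply/subvP => x _; rewrite [x]row_sum_delta; apply: memv_suml => i _.
  apply: memvZ; apply: CW; apply/orthantP => j.
  by rewrite mxE; case: (_ && _).
- apply/seteqP; split=> [_ [y [/orthantP yC [w _ wy]] <-]|_ [_ [x ->] <-]].
    have w0 i : 0 <= w 0 i by have := yC i; rewrite -wy mxE ler0z.
    rewrite -wy.
    exists (\sum_(i < n) a i * `|w ord0 i|)%N.
      by exists (fun i => `|w ord0 i|%N).
    rewrite natr_sum; apply: eq_bigr => i _.
    by rewrite mxE natrM -[in RHS](gez0_abs (w0 i)).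
  pose w : 'rV[int]_n := \row_i (x i)%:Z.
  exists (intvec R w).
    split; last by exists w.
    by apply/orthantP => i; rewrite !mxE ler0z.
  rewrite natr_sum; apply: eq_bigr => i _.
  by rewrite !mxE natrM.
Qed.

(** * Full rank in the absence of a relation *)

Definition no_relation_ge_N1 (n : nat) (a : 'I_n -> nat) : Prop :=
  forall r : 'I_n -> int, (forall i, -1 <= r i) ->
    \sum_(i < n) r i * (a i)%:Z = 0 -> forall i, r i = 0.

Section NoRelation.
Variables (n : nat) (a : 'I_n -> nat).
Hypothesis norel : no_relation_ge_N1 n a.

(** Since [x i >= 0] and [z i <= 1], the differences [x i - z i] form a relation with coefficients
    at least -1. Unit vectors [z] give minimal generation, rounded real coefficients the bound on
    the cone dimension. *)
Lemma no_relation_coef (x : 'I_n -> nat) (z : 'I_n -> int) :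
  (forall i, z i <= 1) ->
  (\sum_(i < n) a i * x i)%N%:Z = \sum_(i < n) z i * (a i)%:Z ->
  forall i, z i = (x i)%:Z.
Proof.
move=> z1 eqxz i; apply/esym/eqP; rewrite -subr_eq0; apply/eqP.
apply: (norel (fun j => (x j)%:Z - z j)) => [j|]; first by have := z1 j; lia.
under eq_bigr do rewrite mulrBl.
rewrite sumrB -eqxz (big_morph Posz PoszD erefl); apply/eqP; rewrite subr_eq0.
by apply/eqP/eq_bigr => j _; rewrite mulrC.
Qed.

Lemma no_relation_mingen (i : 'I_n) (x : 'I_n -> nat) :
  a i = (\sum_(j < n) a j * x j)%N -> x i = 1%N.
Proof.
move=> aE; suff : (i == i)%:R = (x i)%:Z by rewrite eqxx; case.
apply: (no_relation_coef (fun=> _) (fun j => (j == i)%:R)).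
  by move=> j; case: (j == i).
rewrite -aE (bigD1 i) //= eqxx mul1r big1 ?addr0 // => j /negbTE->.
by rewrite mul0r.
Qed.

Lemma no_relation_inj : injective a.
Proof.
move=> i j aij; apply/eqP/negPn/negP => ij.
suff : (i == j : nat) = 1%N by rewrite (negbTE ij).
apply: (no_relation_mingen i (fun k => k == j)).
rewrite (bigD1 j) //= eqxx muln1 big1 ?addn0 // => k /negbTE->.
by rewrite muln0.
Qed.

Lemma no_relation_minimal (B : set nat) :
  B `<=` range a -> generates B (gen_by a) -> B = range a.
Proof.
move=> Ba genB; apply/seteqP; split=> // _ [i _ <-]; apply: contrapT => nBi.
have : gen_by a (a i) by exact: gen_by_mem.
(* The sums that do not use [a i] form a semigroup containing [B]. If [a i] were among them, its own
   coefficient would be both 0 and 1. *)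
rewrite -genB => /(_ [set s | exists2 x : 'I_n -> nat,
  x i = 0%N & s = (\sum_(j < n) a j * x j)%N]) [].
  split; last first.
    move=> b Bb; have [j _ ajb] := Ba b Bb; exists (fun k => (k == j) : nat).
      by case: eqP => // ij; case: nBi; rewrite ij ajb.
    rewrite (bigD1 j) //= eqxx muln1 big1 ?addn0 // => k /negbTE->.
    by rewrite muln0.
  split.
    by exists (fun=> 0%N) => //; rewrite big1 // => j _; rewrite muln0.
  move=> _ _ [x xi ->] [y yi ->]; exists (fun i => x i + y i)%N.
    by rewrite xi yi.
  by rewrite -big_split; apply: eq_bigr => j _; rewrite mulnDr.
by move=> x xi /no_relation_mingen; rewrite xi.
Qed.

Lemma no_relation_embedding_dimension : embedding_dimension (gen_by a) n.
Proof.
exists (range a).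
  by split; [exact: gen_by_generates | exact: no_relation_minimal].
have -> : `I_n = range (@nat_of_ord n).
  apply/seteqP; split=> [k /= kn|_ [i _ <-]]; last exact: ltn_ord.
  by exists (Ordinal kn).
apply: (card_eq_trans (B := [set: 'I_n])); last rewrite card_eq_sym.
  by apply: inj_card_eq => i j _ _; exact: no_relation_inj.
by apply: inj_card_eq => i j _ _; exact: ord_inj.
Qed.

Lemma no_relation_normalescent_ge (R : realType) (k : nat) :
  normalescent R k (gen_by a) -> (n <= k)%N.
Proof.
move=> [m [C [c [[_ [l [v ->]]] [U [CU _] <-] piC]]]].
have lift_a i : exists w : 'rV[int]_m,
    cone (fun i => intvec R (v i)) (intvec R w) /\
    int_linear_map c (intvec R w) = (a i)%:R.
  have : [set (s%:R : R) | s in gen_by a] (a i)%:R.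
    by exists (a i) => //; exact: gen_by_mem.
  by rewrite -piC => -[u [Cu [w _ wu]] cu]; exists w; rewrite wu.
have /choice[w wP] := lift_a.
rewrite leqNgt; apply/negP => Un.
have [|d [d0 [j0 dj0]]] :=
    @exists_dependency R n m (fun i => intvec R (w i)) U _ Un.
  by move=> i; apply: CU; case: (wP i).
pose i0 := [arg max_(i > j0) `|d i|]%O.
have dmax i : `|d i| <= `|d i0|.
  by rewrite /i0; case: Order.TotalTheory.arg_maxP => // i1 _; exact.
have di0 : d i0 != 0.
  by rewrite -normr_gt0; apply: lt_le_trans (dmax j0); rewrite normr_gt0.
pose z i := Num.ceil (- (d i / d i0)).
have dle i : `|d i / d i0| <= 1.
  by rewrite normrM normfV ler_pdivrMr ?normr_gt0 // mul1r.
have z1 i : z i <= 1.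
  rewrite /z -[1]/(1%:~R) ceil_le_int //; have := dle i; rewrite ler_norml; lra.
have zi0 : z i0 = -1 by rewrite /z divff // ceilN ?ceil1 // rpred1.
(* The left side shows that the vector is a lattice point; the right side, whose coefficients are
   nonnegative, that it lies in the cone. *)
have uE : \sum_(i < n) (z i)%:~R *: intvec R (w i) =
    \sum_(i < n) ((z i)%:~R + d i / d i0) *: intvec R (w i).
  under [RHS]eq_bigr do rewrite scalerDl mulrC -scalerA.
  by rewrite big_split /= -scaler_sumr d0 scaler0 addr0.
have : [set (s%:R : R) | s in gen_by a]
    (int_linear_map c (\sum_(i < n) (z i)%:~R *: intvec R (w i))).
  rewrite -piC; exists (\sum_(i < n) (z i)%:~R *: intvec R (w i)) => //; split.
    rewrite uE; apply: cone_comb => i; last by case: (wP i).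
    by rewrite -(opprK (d i / d i0)) subr_ge0; exact: ceil_ge.
  exists (\sum_(i < n) z i *: w i) => //; apply/rowP => j.
  rewrite /intvec mxE !summxE rmorph_sum; apply: eq_bigr => i _.
  by rewrite !mxE rmorphM.
rewrite int_linear_map_sum => -[_ [x ->]].
under [X in _ = X]eq_bigr => i _ do rewrite (wP i).2.
move=> eqx; have : z i0 = (x i0)%:Z.
  apply: no_relation_coef => //; apply/eqP; rewrite -(eqr_int R) -pmulrn.
  rewrite eqx rmorph_sum; apply/eqP/eq_bigr => i _.
  by rewrite rmorphM.
by rewrite zi0.
Qed.

Lemma no_relation_full_rank (R : realType) :
  full_normalescence_rank R (gen_by a).
Proof.
exists n; first exact: no_relation_embedding_dimension.
by split; [exact: gen_by_normalescent | exact: no_relation_normalescent_ge].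
Qed.

End NoRelation.

(** * Counting the tuples with a relation *)

Lemma card_determined_coord (n q : nat) (T : finType)
    (V : 'I_n.+1 -> T -> {ffun 'I_n -> 'I_q} -> 'I_q)
    (A : {pred {ffun 'I_n.+1 -> 'I_q}}) :
  (forall f, f \in A -> exists i t, f i = V i t [ffun j => f (lift i j)]) ->
  (#|A| <= n.+1 * #|T| * q ^ n)%N.
Proof.
move=> AV.
(* [glue] reinserts the determined coordinate, so its image covers [A]. *)
pose glue (u : 'I_n.+1 * T * {ffun 'I_n -> 'I_q}) : {ffun 'I_n.+1 -> 'I_q} :=
  [ffun k => if unlift u.1.1 k is Some j then u.2 j else V u.1.1 u.1.2 u.2].
have -> : (n.+1 * #|T| * q ^ n)%N = #|{: 'I_n.+1 * T * {ffun 'I_n -> 'I_q}}|.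
  by rewrite !card_prod card_ffun !card_ord.
apply: leq_trans (leq_imset_card glue _).
apply: subset_leq_card; apply/fintype.subsetP => f Af.
have [i [t fi]] := AV f Af.
apply/imsetP; exists (i, t, [ffun j => f (lift i j)]) => //.
apply/ffunP => k; rewrite ffunE /=.
by case: unliftP => [j|] ->; rewrite ?ffunE.
Qed.

(** Both summands come from [card_determined_coord]: the parameter is the small entry (less 1) in
    the first, and the list of the other [n] coefficients of a relation in the second. *)
Lemma card_relation_le (n q m : nat) (A : {pred {ffun 'I_n.+1 -> 'I_q}}) :
  (forall f, f \in A -> ~ no_relation_ge_N1 n.+1 (fun i => (f i).+1)) ->
  (0 < q)%N -> (0 < m)%N ->
  (#|A| <= n.+1 * (q %/ m) * q ^ n + n.+1 * (n.+1 * m).+1 ^ n * q ^ n)%N.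
Proof.
case: q A => // q A relA _ m0.
pose small (f : {ffun 'I_n.+1 -> 'I_q.+1}) :=
  [exists i, (f i).+1 * m <= q.+1]%N.
rewrite -(cardID [pred f | small f] A).
rewrite leq_add //.
- rewrite -[X in (_ * X * _)%N](card_ord (q.+1 %/ m)).
  apply: (@card_determined_coord n q.+1 _
    (fun i (t : 'I_(q.+1 %/ m)) b => inord t)) => f.
  rewrite !inE => /andP[_ /existsP[i fim]].
  have fi : (f i < q.+1 %/ m)%N by rewrite leq_divRL.
  by exists i, (Ordinal fi); rewrite inord_val.
- have -> : ((n.+1 * m).+1 ^ n)%N = #|{ffun 'I_n -> 'I_(n.+1 * m).+1}|%N.
    by rewrite card_ffun !card_ord.
  (* Coefficients are stored increased by 1, so that they are natural numbers. [S s b] is the entry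
     whose coefficient is -1; the predecessor below undoes the encoding of entries as [(f i).+1]. *)
  pose S (s : {ffun 'I_n -> 'I_(n.+1 * m).+1}) (b : {ffun 'I_n -> 'I_q.+1}) :=
    \sum_(j < n) ((s j)%:Z - 1) * (b j).+1%:Z.
  apply: (@card_determined_coord n q.+1 _
    (fun i s b => inord `|S s b|%N.-1)) => f.
  rewrite !inE => /andP[/existsPn fbig Af].
  have := relA f Af => /existsNP[r] /not_implyP[r1] /not_implyP[r0] rN0.
  have [/existsP[i /eqP ri]|/existsPn rN1] :=
      boolP [exists i, r i == -1]; last first.
    (* Without a coefficient -1 all terms of the relation are nonnegative, so they all vanish. *)
    case: rN0 => i.
    have rge0 j : 0 <= r j by have := r1 j; have /eqP := rN1 j; lia.
    have rf0 j : true -> 0 <= r j * (f j).+1%:Z by move=> _; apply: mulr_ge0.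
    have /eqP := r0; rewrite psumr_eq0 // => /allP/(_ i).
    by rewrite mem_index_enum mulf_eq0 orbF => /(_ isT)/eqP.
  (* The terms other than the [j]-th are at least [- q.+1], so [r j * (f j).+1 <= n * q.+1]. As
     [(f j).+1 * m > q.+1], this gives [r j <= n * m], hence [r j + 1 <= n.+1 * m]. *)
  have rlt j : (`|(r j + 1)%R| < (n.+1 * m).+1)%N.
    have rj : r j * (f j).+1%:Z <= \sum_(k < n.+1 | k != j) q.+1%:Z.
      move: r0; rewrite (bigD1 j) //= => /eqP; rewrite addr_eq0 => /eqP->.
      rewrite -sumrN; apply: ler_sum => k _.
      have := r1 k; have := ltn_ord (f k); nia.
    have : r j * (f j).+1%:Z <= (n * q.+1)%N%:Z.
      apply: le_trans rj _; rewrite sumr_const cardC1 card_ord.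
      by rewrite -mulr_natl natz PoszM.
    have := fbig j; have := r1 j; rewrite -ltnNge; nia.
  exists i, [ffun j => inord `|(r (lift i j) + 1)%R|%N].
  have -> : S [ffun j => inord `|(r (lift i j) + 1)%R|%N]
      [ffun j => f (lift i j)]
      = (f i).+1%:Z.
    have /eqP := r0; rewrite (bigD1_ord i) //= ri mulN1r.
    rewrite addrC subr_eq0 => /eqP <-.
    apply: eq_bigr => j _; rewrite !ffunE inordK //; congr (_ * _).
    by have := r1 (lift i j); lia.
  by rewrite /= inord_val.
Qed.

(** * The asymptotic estimate *)

Lemma one_sub_prob_full_rank (R : realType) (n q : nat) : (0 < q)%N ->
  1 - prob_full_rank R n q =
  #|[pred f : {ffun 'I_n -> 'I_q} |
      ~~ `[< full_normalescence_rank R (gen_by (fun i => (f i).+1)) >] ]|%:R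
  / (q ^ n)%:R.
Proof.
move=> q0; rewrite /prob_full_rank.
set A := [pred f | _]; set B := [pred f | ~~ _].
have -> : (q ^ n)%N = (#|A| + #|B|)%N.
  by rewrite (cardC A) card_ffun !card_ord.
have : (#|A| + #|B|)%:R != 0 :> R.
  by rewrite pnatr_eq0 -lt0n (cardC A) card_ffun !card_ord expn_gt0 q0.
by move=> ?; rewrite natrD; field; rewrite -natrD.
Qed.

Lemma one_sub_prob_full_rank_le (R : realType) (n q : nat) : (0 < q)%N ->
  0 <= 1 - prob_full_rank R n.+1 q <=
  (n.+1 + n.+1 * (2 * n.+2) ^ n)%:R * q%:R `^ (- n.+1%:R^-1).
Proof.
move=> q0; rewrite one_sub_prob_full_rank //; apply/andP; split.
  by rewrite divr_ge0.
set B := [pred f | _].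
have relB f : f \in B -> ~ no_relation_ge_N1 n.+1 (fun i => (f i).+1).
  rewrite inE => /asboolPn nfull norel; apply: nfull.
  by apply: no_relation_full_rank.
pose T : R := q%:R `^ n.+1%:R^-1.
have TX : T ^+ n.+1 = q%:R.
  by rewrite -powR_mulrn ?powR_ge0 // -powRrM mulVf ?powRr1 // pnatr_eq0.
have T1 : 1 <= T by rewrite -(expr_ge1 (n:=n.+1)) ?powR_ge0 // TX ler1n.
have T0 : 0 < T by lra.
(* This [m] satisfies [T < m <= 2 * T], which makes both terms of the count of order [q ^ n.+1 / T]:
   [q / m <= q / T], and [n.+1 * m + 1 <= n.+2 * m <= 2 * n.+2 * T], where [T ^ n = q / T]. *)
pose m := (Num.truncn T).+1.
have mT : m%:R <= 2 * T.
  have := truncn_le T; rewrite (ltW T0) /m -natr1; lra.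
have Tm : T < m%:R by exact: truncnS_gt.
have m0 : 0 < m%:R :> R by rewrite ltr0n.
rewrite powRN -/T natrX.
have q0R : 0 < q%:R :> R by rewrite ltr0n.
rewrite ler_pdivrMr ?exprn_gt0 //.
have := card_relation_le n q m B relB q0 isT.
rewrite -(ler_nat R) => /le_trans; apply.
rewrite natrD !natrM !natrX -mulrDl exprS mulrA ler_wpM2r ?exprn_ge0 //.
rewrite natrD mulrDl mulrDl lerD //.
  rewrite -!mulrA ler_wpM2l //.
  apply: (@le_trans _ _ (q%:R / m%:R)).
    by rewrite ler_pdivlMr // -natrM ler_nat leq_trunc_div.
  by rewrite mulrC ler_wpM2r // lef_pV2 ?posrE // ltW.
rewrite natrM -!mulrA ler_wpM2l // -TX exprS mulKf ?gt_eqF //.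
rewrite natrX -exprMn lerXn2r ?nnegrE ?mulr_ge0 ?(ltW T0) //.
apply: (@le_trans _ _ (n.+2 * m)%:R).
  by rewrite ler_nat [(n.+2 * m)%N]mulSn -add1n leq_add2r.
by rewrite natrM (mulnC 2) natrM -mulrA ler_wpM2l //.
Qed.

Lemma cvg_powR_natN (R : realType) (p : R) : 0 < p ->
  q%:R `^ (- p) @[q --> \oo] --> (0 : R).
Proof.
(* The shift drops [q = 0]; what remains is the [p]-th power of the harmonic sequence, which tends
   to 0 through positive values. *)
move=> p0; rewrite -cvg_shiftS.
under eq_fun do rewrite -mulN1r powRrM powR_inv1 //.
have /cvg_at_rightP := powR_cvg0 p0; apply; split; last exact: cvg_harmonic.
exact: harmonic_gt0.
Qed.

Theorem theorem3p4 (R : realType) (n : nat) (n_gt0 : (0 < n)%N) :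
  (prob_full_rank R n q @[q --> \oo] --> (1 : R)) /\
  (fun q : nat => 1 - prob_full_rank R n q : R)
    =O_\oo (fun q : nat => q%:R `^ (- n%:R^-1) : R).
Proof.
case: n n_gt0 => // n _; split.
- have cvg_bad : 1 - prob_full_rank R n.+1 q @[q --> \oo] --> (0 : R).
    apply: (squeeze_cvgr (f := fun=> 0) (h := fun q : nat =>
      (n.+1 + n.+1 * (2 * n.+2) ^ n)%:R * q%:R `^ (- n.+1%:R^-1))).
    + by near=> q; apply: one_sub_prob_full_rank_le; near: q; exists 1%N.
    + exact: cvg_cst.
    + rewrite -(mulr0 (n.+1 + n.+1 * (2 * n.+2) ^ n)%:R).
      by apply: cvgMl_tmp; apply: cvg_powR_natN; rewrite invr_gt0 ltr0n.
  have := cvgB (cvg_cst (1 : R)) cvg_bad; rewrite subr0.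
  by rewrite (eq_cvg _ _ (fun q => subKr 1 (prob_full_rank R n.+1 q))); apply.
- apply/eqO_exP; exists (n.+1 + n.+1 * (2 * n.+2) ^ n)%:R.
    by rewrite ltr0n addSn.
  near=> q; have q_gt0 : (0 < q)%N by near: q; exists 1%N.
  have /andP[p0 ple] := @one_sub_prob_full_rank_le R n q q_gt0.
  by rewrite ger0_norm // (ger0_norm (powR_ge0 _ _)).
Unshelve. all: by end_near.
Qed.
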